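(* Let $0<a<b$ and let $R_n$ be the effective resistance of the random network $T_n$ defined in the context. There exists a constant $C$ depending only on $a$ and $b$ such that for every $n\ge1$ and every $t>0$, $$\mathbb{P}\left(|R_n-\mathbb{E}R_n|>t\right)\le 2e^{-t^2/(4C)}.$$
   Context: For $n\ge1$, $T_n$ is the edge-rooted tree consisting of a root vertex $r$ joined by a single edge to a vertex $v$, where $v$ is the root of a complete binary tree with $n-1$ levels (so $T_n$ has $2^{n-1}$ leaves at distance $n$ from $r$). The depth $d(e)$ of an edge $e$ is the number of edges on the path that starts with $e$ and ends at $r$; the edge at $r$ has depth $1$. Each edge $e$ is given resistance $r_e=2^{d(e)-1}X_e$, with the $X_e$ i.i.d. copies of a random variable $X$ taking values in $[a,b]$, $0<a<b$. $R_n$ is the effective resistance between $r$ and the set of leaves of $T_n$. *)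

(* Defs.v *)
From HB Require Import structures.
From mathcomp Require Import all_boot all_order all_algebra.
From mathcomp Require Import all_classical all_reals all_analysis.
Set Implicit Arguments. Unset Strict Implicit. Unset Printing Implicit Defensive.
Import Order.TTheory GRing.Theory Num.Theory.
Local Open Scope classical_set_scope.
Local Open Scope ring_scope.

(* Edges of T_n are indexed by binary words w : seq bool with size w < n:
   the root edge (at r) is [::]; the edge w (of depth d(w) = size w + 1)
   has the two child edges (false :: w) and (true :: w) below it (if
   size w + 1 < n).  Edge w has resistance 2^(d(w)-1) x_w = 2^(size w) x_w. *)

Definition edge_resistance (R : realType) (x : seq bool -> R) (w : seq bool) : R :=
  2 ^+ size w * x w.

Definition parallel (R : realType) (u v : R) : R := (u^-1 + v^-1)^-1.

(* eff_res k x w = effective resistance between the upper endpoint of edge w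
   and the leaves of the subtree formed by edge w and everything below it,
   where this subtree has k levels of edges (k >= 1) — computed by the
   series and parallel laws (valid for trees). *)
Fixpoint eff_res (R : realType) (x : seq bool -> R) (k : nat) (w : seq bool) : R :=
  match k with
  | 0 => 0
  | k'.+1 =>
      edge_resistance x w +
      match k' with
      | 0 => 0
      | _ => parallel (eff_res x k' (false :: w)) (eff_res x k' (true :: w))
      end
  end.

Definition Rn (R : realType) (n : nat) (x : seq bool -> R) : R := eff_res x n [::].

Definition edges_T (n : nat) : set (seq bool) := [set w | (size w < n)%N].

Definition mutually_independent d (T : measurableType d) (R : realType)
  (P : probability T R) (I : eqType) (J : set I) (X : I -> T -> R) : Prop :=
  forall (s : seq I) (B : I -> set R),
    uniq s -> (forall i, i \in s -> J i) -> (forall i, measurable (B i)) ->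
    P (\big[setI/setT]_(i <- s) (X i @^-1` B i)) =
      (\prod_(i <- s) P (X i @^-1` B i))%E.

(* Main.v *)
(* Concentration follows from McDiarmid's inequality once the influence of a
   single edge is controlled.  If two resistance assignments differ only at the
   edge v, then the reciprocals of the effective resistances of the subtrees on
   the path from v to the root differ by at most as much as at v itself:
   conductances in parallel add up, and adding a resistance in series contracts
   differences of conductances.  At v the effective resistance is at least
   a (n - |v|) 2^|v|, and R_n <= b n, so changing X_v changes R_n by at most
   (b - a) (b/a)^2 (|v| + 1)^2 / 2^|v|.  There are 2^l edges with |v| = l, hence
   the squared influences sum to at most 300 (b - a)^2 (b/a)^4, uniformly in n. *)
Require Import Defs.
From HB Require Import structures.
From mathcomp Require Import all_boot all_order all_algebra.
From mathcomp Require Import all_classical all_reals all_analysis.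
From mathcomp Require Import measurable_realfun lra ring zify.
Import Order.TTheory GRing.Theory Num.Theory.
Set Implicit Arguments. Unset Strict Implicit. Unset Printing Implicit Defensive.
Local Open Scope classical_set_scope.
Local Open Scope ring_scope.

(** * McDiarmid's inequality *)

Section independent_integral.
Context d (T : measurableType d) (R : realType) (P : probability T R).

Lemma measurable_id_g_sigma (G : set (set T)) : G `<=` measurable ->
  measurable_fun setT (idfun : T -> g_sigma_algebraType G).
Proof.
move=> Gm _ /= A mA; rewrite setTI preimage_id.
by move: A mA; apply: smallest_sub => //; exact: sigma_algebra_measurable.
Qed.

(** Pi-lambda argument: for fixed [B], both [P (A & B)], with [&] for intersection, and [P A * P B]
    are finite measures in [A]. They agree on the pi-system [G], hence on the sigma-algebra it
    generates. *)
Lemma independent_g_sigma (G : set (set T)) (B : set T) :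
  G `<=` measurable -> setI_closed G -> G setT -> measurable B ->
  (forall A, G A -> P (A `&` B) = (P A * P B)%E) ->
  forall A, <<s G >> A -> P (A `&` B) = (P A * P B)%E.
Proof.
move=> Gm GI GT mB GB A sA.
have PBfin : (0 <= fine (P B))%R by rewrite fine_ge0.
pose m1 : {measure set T -> \bar R} := mrestr P mB.
pose m2 : {measure set T -> \bar R} := mscale (NngNum PBfin) P.
have -> : (P A * P B)%E = m2 A.
  by rewrite /m2 /= /mscale /= fineK ?fin_num_measure// muleC.
rewrite -[LHS]/(m1 A).
apply: (g_sigma_algebra_measure_unique G Gm (fun=> setT)) => //.
- by rewrite bigcup_const.
- move=> A0 GA0; rewrite /m1 /m2 /= /mscale /mrestr /= GB//.
  by rewrite fineK ?fin_num_measure// muleC.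
- move=> _; rewrite /m1 /= /mrestr setTI.
  by rewrite (le_lt_trans (probability_le1 P mB)) ?ltry.
Qed.

Variables G1 G2 : set (set T).
Hypotheses (G1m : G1 `<=` measurable) (G2m : G2 `<=` measurable).
Hypotheses (G1I : setI_closed G1) (G2I : setI_closed G2).
Hypotheses (G1T : G1 setT) (G2T : G2 setT).
Hypothesis indG : forall A B, G1 A -> G2 B -> P (A `&` B) = (P A * P B)%E.

Let E1 : measurableType _ := g_sigma_algebraType G1.
Let E2 : measurableType _ := g_sigma_algebraType G2.

(* The law of the diagonal map x |-> (x, x) from T to T with the sigma-algebra
   of G1 times T with the sigma-algebra of G2 is the product of the two
   restrictions of P: this replaces the joint law of independent vectors. *)
Lemma independent_integral (g : E1 * E2 -> \bar R) :
  measurable_fun setT g -> (forall z, 0 <= g z)%E ->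
  measurable_fun setT (fun x : T => \int[P]_y g (x, y))%E /\
  (\int[P]_x g (x, x) = \int[P]_x \int[P]_y g (x, y))%E.
Proof.
move=> mg g0.
have mid1 := measurable_id_g_sigma G1m.
have mid2 := measurable_id_g_sigma G2m.
pose X1 : {mfun T >-> E1} :=
  HB.pack (idfun : T -> E1) (isMeasurableFun.Build _ _ _ _ _ mid1).
pose X2 : {mfun T >-> E2} :=
  HB.pack (idfun : T -> E2) (isMeasurableFun.Build _ _ _ _ _ mid2).
pose P1 : probability E1 R := distribution P X1.
pose P2 : probability E2 R := distribution P X2.
have mdiag : measurable_fun setT
  (fun x : T => (X1 x, X2 x)).
  exact/measurable_fun_pair.
pose D : {mfun T >-> (E1 * E2)%type} :=
  HB.pack (fun x : T => (X1 x, X2 x)) (isMeasurableFun.Build _ _ _ _ _ mdiag).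
have Fe x : (\int[P2]_y g (x, y) = \int[P]_y g (x, y))%E.
  rewrite ge0_integral_distribution//.
  exact: measurableT_comp.
have mF := measurable_fun_fubini_tonelli_F (m2 := P2) _ mg g0.
split.
  apply: (eq_measurable_fun (fubini_F P2 g \o X1)).
    by move=> x _; rewrite /= /fubini_F Fe.
  exact: measurableT_comp.
transitivity (\int[distribution P D]_z g z)%E.
  by rewrite ge0_integral_distribution.
transitivity (\int[P1 \x P2]_z g z)%E.
  apply: eq_measure_integral => A mA _.
  rewrite -(@product_measure_unique _ _ _ _ _ P1 P2 (distribution P D))//.
  move=> A1 A2 mA1 mA2; rewrite /= /distribution /pushforward /=.
  rewrite !preimage_id.
  have -> : D @^-1` (A1 `*` A2) = A1 `&` A2 by apply/seteqP; split=> x.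
  (* The product formula passes from [G1] and [G2] to the generated sigma-algebras one factor at a
     time. *)
  apply: (independent_g_sigma G1m) => //.
  - by have := mid2 measurableT _ mA2; rewrite setTI preimage_id.
  - move=> B GB; rewrite setIC muleC.
    apply: (independent_g_sigma G2m) => //; first exact: G1m.
    by move=> C GC; rewrite setIC muleC; exact: indG.
rewrite fubini_tonelli1//.
rewrite ge0_integral_distribution//; last first.
  by move=> y; exact: integral_ge0.
by apply: eq_integral => x _; rewrite /= /fubini_F Fe.
Qed.

End independent_integral.

(** * Exponential moments of bounded variables *)

(** The linear term will have mean zero for a centred variable, which leaves a sub-Gaussian bound.
    For [x > 1/2], [x <= 2 x^2]. Otherwise [e^x <= 1/(1-x) <= 1 + x + 2x^2], because
    [(1-x)(1+x+2x^2) = 1 + x^2(1-2x)]. *)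
Lemma expR_le_addr_expR_sqr (R : realType) (x : R) :
  expR x <= x + expR (2 * x ^+ 2).
Proof.
have [x_le|x_gt] := lerP x (1 / 2); last first.
  have : expR x <= expR (2 * x ^+ 2) by rewrite ler_expR; nra.
  by move: x_gt; lra.
have h : (1 - x) * expR x <= 1.
  have h := expR_ge1Dx (- x).
  rewrite -[leRHS](expRxMexpNx_1 x) mulrC ler_wpM2l ?expR_ge0//.
have : expR x <= 1 + x + 2 * x ^+ 2.
  have e0 := expR_ge0 x.
  rewrite -(@ler_pM2l _ (1 - x)); last by lra.
  apply: (le_trans h); nra.
have := expR_ge1Dx (2 * x ^+ 2).
by lra.
Qed.

Section expectation.
Context d (T : measurableType d) (R : realType) (P : probability T R).

Lemma bounded_integrable (h : T -> R) (M : R) : measurable_fun setT h ->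
  (forall x, `|h x| <= M) -> P.-integrable setT (EFin \o h).
Proof.
move=> mh hM; apply: measurable_bounded_integrable => //.
  by rewrite /= probability_setT ltry.
exists M; split; first exact: num_real.
by move=> y My x _; exact: le_trans (hM x) (ltW My).
Qed.

Lemma Rintegral_le_cst (h : T -> R) (M c : R) : measurable_fun setT h ->
  (forall x, `|h x| <= M) -> (forall x, h x <= c) -> \int[P]_x h x <= c.
Proof.
move=> mh hM hc.
have : \int[P]_x h x <= \int[P]_(x in setT) c.
  apply: le_Rintegral => //.
    exact: bounded_integrable hM.
  exact: (@bounded_integrable (cst c) `|c|).
by rewrite Rintegral_cst//= probability_setT mulr1.
Qed.

Lemma Rintegral_ge_cst (h : T -> R) (M c : R) : measurable_fun setT h ->
  (forall x, `|h x| <= M) -> (forall x, c <= h x) -> c <= \int[P]_x h x.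
Proof.
move=> mh hM hc.
have : \int[P]_(x in setT) c <= \int[P]_x h x.
  apply: le_Rintegral => //.
    exact: (@bounded_integrable (cst c) `|c|).
  exact: bounded_integrable hM.
by rewrite Rintegral_cst//= probability_setT mulr1.
Qed.

(** Hoeffding's lemma with the constant 2 in place of 1/8. The oscillation bound gives
    [|h - mu| <= c]; the pointwise bound on the exponential is applied to [l (h - mu)] and
    integrated, and the linear term vanishes. *)
Lemma mgf_oscillation (h : T -> R) (M c l : R) : measurable_fun setT h ->
  (forall x, `|h x| <= M) -> (forall x y, h x <= h y + c) ->
  (\int[P]_x (expR (l * h x))%:E <=
   (expR (l * \int[P]_x h x + 2 * l ^+ 2 * c ^+ 2))%:E)%E.
Proof.
move=> mh hM hc; set mu := Rintegral P setT h.
have ih := bounded_integrable mh hM.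
have mu_le x : mu <= h x + c.
  exact: Rintegral_le_cst (hM) _.
have mu_ge x : h x - c <= mu.
  by apply: Rintegral_ge_cst (hM) _ => // y; have := hc x y; lra.
have c0 : 0 <= c by have := hc point point; lra.
set K := expR (l * mu).
set q := expR (2 * l ^+ 2 * c ^+ 2).
have pt x : expR (l * h x) <= K * l * (h x - mu) + K * q.
  have -> : l * h x = l * mu + l * (h x - mu) by ring.
  rewrite expRD -/K -mulrA -mulrDr ler_wpM2l ?expR_ge0//.
  apply: (le_trans (expR_le_addr_expR_sqr _)).
  rewrite lerD2l ler_expR -mulrA ler_pM2l// exprMn ler_wpM2l ?sqr_ge0//.
  have := mu_le x; have := mu_ge x; nra.
have mE : measurable_fun setT (fun x => expR (l * h x)).
  by apply: measurableT_comp => //; exact: measurable_funM.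
have mL : measurable_fun setT (fun x => K * l * (h x - mu) + K * q).
  apply: measurable_funD => //; apply: measurable_funM => //.
  exact: measurable_funB.
have hmuc x : `|h x - mu| <= c.
  by rewrite ler_norml; have := mu_le x; have := mu_ge x; lra.
have ihmu : P.-integrable setT (EFin \o (fun x => h x - mu)).
  by apply: bounded_integrable hmuc; exact: measurable_funB.
have ic (k : R) : P.-integrable setT (EFin \o cst k).
  exact: (@bounded_integrable (cst k) `|k|).
apply: (@le_trans _ _ (\int[P]_x (K * l * (h x - mu) + K * q)%:E)%E).
  apply: ge0_le_integral => //.
  - exact/measurable_EFinP.
  - exact/measurable_EFinP.
  - by move=> x _; rewrite lee_fin.
have iL : P.-integrable setT (EFin \o (fun x => K * l * (h x - mu))).
  apply: (@bounded_integrable _ (`|K * l| * c)) => //.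
    by apply: measurable_funM => //; exact: measurable_funB.
  by move=> x; rewrite normrM ler_wpM2l.
under eq_integral do rewrite EFinD.
rewrite integralD//; last exact: ic.
rewrite integral_cst//= probability_setT mule1.
have -> : (\int[P]_x (K * l * (h x - mu))%:E = 0)%E.
  rewrite -[LHS]fineK; last exact: integrable_fin_num iL.
  congr EFin; rewrite -[LHS]/(\int[P]_x (K * l * (h x - mu))) RintegralZl//.
  rewrite (RintegralB _ ih (ic mu))// Rintegral_cst//= probability_setT mulr1.
  by rewrite subrr mulr0.
by rewrite add0e expRD.
Qed.

End expectation.

(* This avoids putting a sigma-algebra on the space I -> R, and lets the same f
   be used with several sigma-algebras on the sample space. *)
Definition coord_measurable (R : realType) (I : Type) (f : (I -> R) -> R) :=
  forall d (E : measurableType d) (Y : I -> E -> R),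
    (forall i, measurable_fun setT (Y i)) ->
    measurable_fun setT (fun e => f (fun i => Y i e)).

(** * Cylinder sets as pi-systems for finitely many variables *)

Section cylinder.
Context d (T : measurableType d) (R : realType) (I : choiceType) (X : I -> T -> R).
Hypothesis mX : forall i, measurable_fun setT (X i).

Definition cylinder (s : seq I) : set (set T) :=
  [set A | exists2 B : I -> set R, (forall i, measurable (B i)) &
                  A = \big[setI/setT]_(i <- s) (X i @^-1` B i)].

Lemma cylinder_measurable s : cylinder s `<=` measurable.
Proof.
move=> _ [B mB ->]; apply: bigsetI_measurable => i _.
by rewrite -[X in measurable X]setTI; exact: mX.
Qed.

Lemma cylinder_setI_closed s : setI_closed (cylinder s).
Proof.
move=> _ _ [A mA ->] [B mB ->]; exists (fun i => A i `&` B i).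
  by move=> i; exact: measurableI.
rewrite -big_split; apply: eq_bigr => i _.
by rewrite preimage_setI.
Qed.

Lemma cylinder_setT s : cylinder s setT.
Proof.
exists (fun=> setT) => //.
by rewrite big1.
Qed.

Lemma cylinder_coord s i : i \in s ->
  measurable_fun setT (X i : g_sigma_algebraType (cylinder s) -> R).
Proof.
move=> si _ /= B mB; rewrite setTI; apply: sub_sigma_algebra.
exists (fun j => if j == i then B else setT).
  by move=> j; case: ifP.
rewrite -bigcap_seq; apply/seteqP; split=> [om Bom j _ /=|om /(_ i si) /=].
  by case: ifP => // /eqP ->.
by rewrite eqxx.
Qed.

End cylinder.

(** * Exponential moments by exposing one coordinate at a time *)

Section mcdiarmid.
Context d (T : measurableType d) (R : realType) (P : probability T R).
Context (I : choiceType) (J : set I) (X : I -> {RV P >-> R}) (a b : R).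
Hypothesis indX : mutually_independent P J (fun i => (X i : T -> R)).
Hypothesis boxX : forall i, J i -> forall om, a <= X i om <= b.

Lemma cylinder_indep (i : I) (s : seq I) (A B : set T) :
  uniq (i :: s) -> (forall j, j \in i :: s -> J j) ->
  cylinder (fun i => (X i : T -> R)) [:: i] A ->
  cylinder (fun i => (X i : T -> R)) s B -> P (A `&` B) = (P A * P B)%E.
Proof.
move=> us sJ [A' mA ->] [B' mB ->].
have /= /andP[nis us'] := us.
(* As [i] is not in [s], the two families of test sets merge into one, to which mutual independence
   applies. *)
pose C j := if j == i then A' i else B' j.
have mC j : measurable (C j) by rewrite /C; case: ifP.
have CB : \big[setI/setT]_(j <- s) (X j @^-1` B' j) =
          \big[setI/setT]_(j <- s) (X j @^-1` C j).
  apply: eq_big_seq => j js; rewrite /C; case: eqP => // ji.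
  by rewrite -ji js in nis.
have CA : X i @^-1` A' i = X i @^-1` C i by rewrite /C eqxx.
have := indX us sJ mC.
rewrite big_seq1 CB CA !big_cons (indX us' _ mC)//.
by move=> j js; apply: sJ; rewrite inE js orbT.
Qed.

(** Coordinates in [s] are random and the others frozen at [x], so that an induction on [s] can
    release them one by one. *)
Definition resample (x : I -> R) (s : seq I) (om : T) : I -> R :=
  fun i => if i \in s then X i om else x i.

Definition in_box (x : I -> R) := forall i, J i -> a <= x i <= b.

Lemma resample_in_box x s om : in_box x -> in_box (resample x s om).
Proof.
by move=> bx i Ji; rewrite /resample; case: ifP => _; [exact: boxX|exact: bx].
Qed.

Variables (f : (I -> R) -> R) (M : R) (c : I -> R).
Hypothesis mf : coord_measurable f.
Hypothesis fM : forall x, in_box x -> 0 <= f x <= M.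
Hypothesis fc : forall i x y, J i -> in_box x -> in_box y ->
  (forall j, j != i -> x j = y j) -> f x <= f y + c i.

Lemma measurable_resample x s : measurable_fun setT (fun om => f (resample x s om)).
Proof. apply: (mf (Y := fun i om => resample x s om i)) => i.
by rewrite /resample /=; case: (i \in s). Qed.

Lemma resample_norm_le x s om : in_box x -> `|f (resample x s om)| <= M.
Proof.
move=> bx; have /andP[f0 f1] := fM (resample_in_box s om bx).
by rewrite ger0_norm.
Qed.

(** Induction on [s], for all base points [x]. With coordinate [i] fixed, the induction hypothesis
    bounds the integral over the rest in terms of its mean [h]. Then [h] oscillates by at most
    [c i], and [mgf_oscillation] handles the integral over coordinate [i]. *)
Lemma mcdiarmid_mgf (l : R) (s : seq I) (x : I -> R) :
  uniq s -> (forall i, i \in s -> J i) -> in_box x ->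
  (\int[P]_om (expR (l * f (resample x s om)))%:E <=
   (expR (l * \int[P]_om f (resample x s om)
          + 2 * l ^+ 2 * \sum_(i <- s) c i ^+ 2))%:E)%E.
Proof.
elim: s x => [|i s IHs] x.
  move=> _ _ bx.
  have E (om : T) : resample x [::] om = x by apply/funext.
  under eq_integral do rewrite E.
  under eq_Rintegral do rewrite E.
  rewrite integral_cst// Rintegral_cst//= probability_setT mule1 mulr1.
  by rewrite big_nil mulr0 addr0.
move=> us sJ bx; have /= /andP[nis us'] := us.
have sJ' j : j \in s -> J j by move=> js; apply: sJ; rewrite inE js orbT.
have Ji : J i by apply: sJ; rewrite mem_head.
pose G1 := cylinder (fun i => (X i : T -> R)) [:: i].
pose G2 := cylinder (fun i => (X i : T -> R)) s.
(* Decoupling: [om] drives coordinate [i] and [om'] drives those in [s]; the diagonal restores the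
   original vector. *)
pose phi om om' := resample (resample x [:: i] om) s om'.
have phiE om : phi om om = resample x (i :: s) om.
  apply/funext => j; rewrite /phi /resample /= !inE.
  by case: (j \in s); rewrite ?orbT// orbF.
have box1 om : in_box (resample x [:: i] om) by exact: resample_in_box.
have mphi (u : R -> R) : measurable_fun setT u -> measurable_fun setT
    ((fun z => (u (f (phi z.1 z.2)))%:E)
       : g_sigma_algebraType G1 * g_sigma_algebraType G2 -> \bar R).
  move=> mu; apply/measurable_EFinP; apply: measurableT_comp => //.
  apply: (mf (Y := fun j (z : g_sigma_algebraType G1 * g_sigma_algebraType G2) =>
                    phi z.1 z.2 j)) => j.
  rewrite /phi /resample /=; case: (boolP (j \in s)) => [js|_].
    apply: (measurableT_comp (f := (X j : g_sigma_algebraType G2 -> R))).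
      exact: cylinder_coord.
    exact: measurable_snd.
  case: (boolP (j \in [:: i])) => [ji|_] //.
  apply: (measurableT_comp (f := (X j : g_sigma_algebraType G1 -> R))).
    exact: cylinder_coord.
  exact: measurable_fst.
have mXT (j : I) : measurable_fun setT (X j : T -> R) by [].
(* Used twice: with the identity for the mean, and with [r |-> exp (l r)] for the exponential
   moment. *)
have fubini (u : R -> R) : measurable_fun setT u ->
    (forall z, 0 <= u (f (phi z.1 z.2))) ->
    measurable_fun setT (fun om => \int[P]_om' (u (f (phi om om')))%:E)%E /\
    (\int[P]_om (u (f (resample x (i :: s) om)))%:E =
     \int[P]_om \int[P]_om' (u (f (phi om om')))%:E)%E.
  move=> mu u0.
  have mcyl s' := cylinder_measurable (s := s') mXT.
  have Icyl s' := cylinder_setI_closed (s := s') (X := fun i => (X i : T -> R)).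
  have Tcyl s' := cylinder_setT (fun i => (X i : T -> R)) s'.
  have [mg <-] := independent_integral (mcyl [:: i]) (mcyl s) (Icyl [:: i])
    (Icyl s) (Tcyl [:: i]) (Tcyl s) (fun A B => cylinder_indep us sJ)
    (mphi u mu) (fun z => u0 z).
  by split=> //; under [RHS]eq_integral do rewrite phiE.
(* The conditional expectation given coordinate [i]. *)
pose h om := \int[P]_om' f (phi om om').
have fphiM om om' : `|f (phi om om')| <= M by exact: resample_norm_le.
have ih om : P.-integrable setT (EFin \o (fun om' => f (phi om om'))).
  exact: bounded_integrable (measurable_resample _ _) (fphiM om).
have hE om : (\int[P]_om' (f (phi om om'))%:E = (h om)%:E)%E.
  by rewrite fineK//; exact: integrable_fin_num (ih om).
have [mh0 hint] := fubini id (@measurable_id _ _ _)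
  (fun z => (andP (fM (resample_in_box s z.2 (box1 z.1)))).1).
have mh : measurable_fun setT h.
  by apply/measurable_EFinP; apply: eq_measurable_fun mh0 => om _; exact: hE.
have hbound om : `|h om| <= M.
  have h0 om' : 0 <= f (phi om om') <= M by exact/fM/resample_in_box.
  rewrite ger0_norm; last by apply: Rintegral_ge0 => om' _; have /andP[] := h0 om'.
  apply: (Rintegral_le_cst P (measurable_resample _ _) (fphiM om)) => om'.
  by have /andP[] := h0 om'.
have hosc om1 om2 : h om1 <= h om2 + c i.
  have ic : P.-integrable setT (EFin \o cst (c i)).
    exact: (bounded_integrable P (h := cst (c i)) (M := `|c i|)).
  have -> : h om2 + c i = \int[P]_om' (f (phi om2 om') + c i).
    rewrite (RintegralD _ (ih om2) ic)// Rintegral_cst//= probability_setT.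
    by rewrite mulr1.
  apply: le_Rintegral => //; first exact: integrableD (ih om2) ic.
  move=> om' _; apply: fc => //; try exact/resample_in_box.
  move=> j ji; rewrite /phi /resample /=; case: (j \in s) => //.
  by rewrite inE (negbTE ji).
have Eh : \int[P]_om f (resample x (i :: s) om) = \int[P]_om h om.
  rewrite /Rintegral hint; congr fine.
  by apply: eq_integral => om _; exact: hE.
have mexp : measurable_fun setT (fun r : R => expR (l * r)).
  by apply: measurableT_comp => //; exact: mulrl_measurable.
have [mE ->] := fubini _ mexp (fun z => expR_ge0 _).
set S := \sum_(j <- s) c j ^+ 2.
have step om : (\int[P]_om' (expR (l * f (phi om om')))%:E <=
    (expR (2 * l ^+ 2 * S))%:E * (expR (l * h om))%:E)%E.
  by rewrite -EFinM -expRD addrC; apply: IHs.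
apply: (@le_trans _ _ (\int[P]_om
    ((expR (2 * l ^+ 2 * S))%:E * (expR (l * h om))%:E)))%E.
  apply: ge0_le_integral => //.
  - by move=> om _; apply: integral_ge0 => om' _; rewrite lee_fin expR_ge0.
  - apply: measurable_funeM; apply/measurable_EFinP.
    by apply: measurableT_comp => //; exact: measurable_funM.
rewrite ge0_integralZl//; last first.
  by apply/measurable_EFinP; apply: measurableT_comp => //; exact: measurable_funM.
apply: le_trans.
  by apply: lee_wpmul2l; [rewrite lee_fin expR_ge0|exact: mgf_oscillation hosc].
rewrite -EFinM -expRD Eh big_cons lee_fin ler_expR -/S; lra.
Qed.
End mcdiarmid.

(** * Tail bounds from exponential moments *)

Section chernoff.
Context d (T : measurableType d) (R : realType) (P : probability T R).

Lemma subgaussian_upper_tail (Z : T -> R) (m S t : R) :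
  measurable_fun setT Z -> 0 < S -> 0 < t ->
  (forall l, \int[P]_om (expR (l * Z om))%:E <=
             (expR (l * m + 2 * l ^+ 2 * S))%:E)%E ->
  (P [set om | (t < Z om - m)%R] <= (expR (- t ^+ 2 / (8 * S)))%:E)%E.
Proof.
move=> mZ S0 t0 mgf.
pose Y : {RV P >-> R} := HB.pack Z (isMeasurableFun.Build _ _ _ _ _ mZ).
(* The minimiser of [2 l^2 S - l t], with minimum [- t^2 / (8 S)]. *)
pose l := t / (4 * S).
have l0 : 0 < l by rewrite divr_gt0// mulr_gt0.
apply: (@le_trans _ _ (P [set om | Y om >= m + t]%R)).
  apply: le_measure; rewrite ?inE.
  - have -> : [set om | t < Z om - m] = [set om | cst (m + t) om < Z om].
      by apply/seteqP; split=> om /=; rewrite ltrBrDl.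
    by rewrite -[X in measurable X]setTI; exact: measurable_fun_ltr.
  - rewrite -[X in measurable X]setTI.
    exact: (measurable_fun_ler (measurable_cst (m + t)) mZ).
  - by move=> om /=; rewrite ltrBrDl => /ltW.
apply: (le_trans (chernoff Y _ l0)).
rewrite /mmt_gen_fun unlock.
have -> : (\int[P]_om ((expR \o l \o* Y) om)%:E = \int[P]_om (expR (l * Z om))%:E)%E.
  by apply: eq_integral => om _ /=; rewrite mulrC.
apply: (le_trans (lee_wpmul2r _ (mgf l))); first by rewrite lee_fin expR_ge0.
rewrite -EFinM -expRD lee_fin ler_expR.
rewrite le_eqVlt; apply/orP; left; apply/eqP.
rewrite /l; field.
by rewrite gt_eqF.
Qed.

(** The moment bound is assumed for [l] of either sign, so the one-sided estimate also applies to
    [-Z]. *)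
Lemma subgaussian_tail (Z : T -> R) (m S t : R) :
  measurable_fun setT Z -> 0 < S -> 0 < t ->
  (forall l, \int[P]_om (expR (l * Z om))%:E <=
             (expR (l * m + 2 * l ^+ 2 * S))%:E)%E ->
  (P [set om | (t < `|Z om - m|)%R] <= 2%:E * (expR (- t ^+ 2 / (8 * S)))%:E)%E.
Proof.
move=> mZ S0 t0 mgf.
have mW : measurable_fun setT (fun om => - Z om) by exact: measurable_funN.
have up := subgaussian_upper_tail mZ S0 t0 mgf.
have lo : (P [set om | (t < - Z om - - m)%R] <= (expR (- t ^+ 2 / (8 * S)))%:E)%E.
  apply: subgaussian_upper_tail => // l.
  have := mgf (- l); rewrite sqrrN mulNr -mulrN.
  by under eq_integral do rewrite mulNr -mulrN.
have mA (W : T -> R) k : measurable_fun setT W -> measurable [set om | t < W om - k].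
  move=> mW'; rewrite -[X in measurable X]setTI.
  by apply: measurable_fun_ltr => //; exact: measurable_funB.
have -> : [set om | t < `|Z om - m|] =
    [set om | t < Z om - m] `|` [set om | t < - Z om - - m].
  apply/seteqP; split=> om /=; rewrite lter_normr/= opprB opprK addrC [m - _]addrC.
    by move=> /orP.
  by move/orP.
apply: (le_trans (measureU2 _ _ _)); [exact: mA|exact: mA|].
by rewrite (_ : 2%:E = 1 + 1)%E// ge0_muleDl// !mul1e leeD.
Qed.

End chernoff.

(** The sharp exponent would be [-2 t^2 / S]; the weaker [- t^2 / (8 S)] comes from the constant in
    [mgf_oscillation] and only affects the value of [C]. *)
Lemma mcdiarmid d (T : measurableType d) (R : realType) (P : probability T R)
    (I : choiceType) (J : set I) (X : I -> {RV P >-> R}) (a b : R)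
    (f : (I -> R) -> R) (M : R) (c : I -> R) (s : seq I) (x : I -> R) (S t : R) :
  mutually_independent P J (fun i => (X i : T -> R)) ->
  (forall i, J i -> forall om, a <= X i om <= b) ->
  coord_measurable f ->
  (forall y, in_box J a b y -> 0 <= f y <= M) ->
  (forall i y z, J i -> in_box J a b y -> in_box J a b z ->
    (forall j, j != i -> y j = z j) -> f y <= f z + c i) ->
  uniq s -> (forall i, i \in s -> J i) -> in_box J a b x ->
  0 < S -> \sum_(i <- s) c i ^+ 2 <= S -> 0 < t ->
  (P [set om | (t < `|f (resample X x s om) -
                      \int[P]_om' f (resample X x s om')|)%R] <=
   2%:E * (expR (- t ^+ 2 / (8 * S)))%:E)%E.
Proof.
move=> indX boxX mf fM fc us sJ bx S0 cS t0.
apply: subgaussian_tail => //; first exact: measurable_resample.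
move=> l; apply: (le_trans (mcdiarmid_mgf indX boxX mf fM fc l us sJ bx)).
by rewrite lee_fin ler_expR lerD2l ler_wpM2l// mulr_ge0// sqr_ge0.
Qed.

(** * Effective resistances *)

Section resistance.
Variable R : realType.
Implicit Types (x y : seq bool -> R) (a b : R) (w v : seq bool).

Lemma eff_res1 x w : eff_res x 1 w = 2 ^+ size w * x w.
Proof. by rewrite /= addr0. Qed.

Lemma eff_resS x k w : eff_res x k.+2 w = 2 ^+ size w * x w +
  parallel (eff_res x k.+1 (false :: w)) (eff_res x k.+1 (true :: w)).
Proof. by []. Qed.

Lemma eq_eff_res x y k w :
  (forall u, (size u < k)%N -> x (u ++ w) = y (u ++ w)) ->
  eff_res x k w = eff_res y k w.
Proof.
elim: k w => [//|[_|k IHk]] w xy.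
  by rewrite !eff_res1 (xy [::]).
rewrite !eff_resS (xy [::])//; congr (_ + parallel _ _); apply: IHk => u uk;
  by rewrite -cat_rcons xy// size_rcons.
Qed.

Lemma parallel_bounds (u v p q : R) : 0 < p -> p <= u <= q -> p <= v <= q ->
  p / 2 <= parallel u v <= q / 2.
Proof.
move=> p0 /andP[pu uq] /andP[pv vq]; rewrite /parallel.
have u0 : 0 < u by lra.
have v0 : 0 < v by lra.
have q0 : 0 < q by lra.
have -> : (u^-1 + v^-1)^-1 = u * v / (u + v).
  by field; rewrite !gt_eqF//= ?addr_gt0.
have uv : 0 < u + v by lra.
rewrite ler_pdivlMr// ler_pdivrMr//; nra.
Qed.

(** Edge resistances double with each level, while two comparable branches in parallel halve the
    resistance. The effects cancel, so each level contributes between [2^|w| a] and [2^|w| b]. *)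
Lemma eff_res_bounds x a b n k w : 0 < a -> (k.+1 + size w <= n)%N ->
  (forall v, (size v < n)%N -> a <= x v <= b) ->
  2 ^+ size w * (k.+1%:R * a) <= eff_res x k.+1 w <= 2 ^+ size w * (k.+1%:R * b).
Proof.
move=> a0 + box; elim: k w => [|k IHk] w wn.
  have /andP[ax xb] := box w wn.
  by rewrite eff_res1 !mul1r !ler_pM2l ?exprn_gt0// ax.
have /andP[ax xb] : a <= x w <= b by apply: box; lia.
have c0 : 0 < 2 ^+ size w :> R by rewrite exprn_gt0.
have h0 := IHk (false :: w) ltac:(rewrite /=; lia).
have h1 := IHk (true :: w) ltac:(rewrite /=; lia).
rewrite eff_resS.
have k0 : 0 < k.+1%:R :> R by rewrite ltr0n.
have p0 : 0 < 2 ^+ (size w).+1 * (k.+1%:R * a) by rewrite !mulr_gt0// exprn_gt0.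
have /andP[] := parallel_bounds p0 h0 h1.
move: c0 ax xb; rewrite exprS -[k.+2%:R]natr1.
set c := 2 ^+ size w; set r := parallel _ _; set K := k.+1%:R => c0 ax xb h2 h3.
have := ler_wpM2l (ltW c0) ax; have := ler_wpM2l (ltW c0) xb.
by move=> ? ?; apply/andP; split; lra.
Qed.

(* Conductances add up in parallel, and h |-> 1/(r+h) contracts differences of
   conductances, so perturbations of 1/R do not grow on the way to the root. *)
Lemma inv_addl_contract (r u u' : R) : 0 <= r -> 0 < u -> 0 < u' ->
  `|(r + u)^-1 - (r + u')^-1| <= `|u^-1 - u'^-1|.
Proof.
move=> r0 u0 u'0.
have ru : 0 < r + u by lra.
have ru' : 0 < r + u' by lra.
have -> : (r + u)^-1 - (r + u')^-1 = (u' - u) / ((r + u) * (r + u')).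
  by field; rewrite !gt_eqF.
have -> : u^-1 - u'^-1 = (u' - u) / (u * u').
  by field; rewrite !gt_eqF.
rewrite !normrM ler_wpM2l// !normfV ler_pV2 ?inE ?unitfE ?normr_gt0 ?normr_eq0
  ?gt_eqF ?mulr_gt0//.
by rewrite !gtr0_norm ?mulr_gt0//; nra.
Qed.

(** Induction on the number of levels below [w], which climbs the path from [v] to the root. At
    [w = v] the resistances differ by [2^|v| (y v - x v)], and each is at least [2^|v| (n - |v|) a];
    above [v] the bound is only propagated. *)
Lemma eff_res_inv_lipschitz x y a b n v k w : 0 < a ->
  (k.+1 + size w = n)%N ->
  (forall u, (size u < n)%N -> a <= x u <= b) ->
  (forall u, (size u < n)%N -> a <= y u <= b) ->
  (forall u, u != v -> x u = y u) -> suffix w v -> (size v < n)%N ->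
  `|(eff_res x k.+1 w)^-1 - (eff_res y k.+1 w)^-1| <=
  (b - a) / (2 ^+ size v * ((n - size v)%:R * a) ^+ 2).
Proof.
move=> a0 + bx bxy xy + vn.
have nsuf u k' : ~~ suffix u v -> eff_res x k' u = eff_res y k' u.
  move=> uv; apply: eq_eff_res => t _; apply: xy; apply: contra uv => /eqP <-.
  exact: suffix_suffix.
have pos z k' u : (forall t, (size t < n)%N -> a <= z t <= b) ->
    (k'.+1 + size u <= n)%N -> 0 < 2 ^+ size u * (k'.+1%:R * a) <= eff_res z k'.+1 u.
  move=> bz /(eff_res_bounds a0)/(_ bz) /andP[-> _]; rewrite andbT.
  by rewrite !mulr_gt0 ?exprn_gt0 ?ltr0n.
have root k' : (k'.+1 + size v = n)%N ->
    `|(eff_res x k'.+1 v)^-1 - (eff_res y k'.+1 v)^-1| <=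
    (b - a) / (2 ^+ size v * ((n - size v)%:R * a) ^+ 2).
  move=> k'n; have -> : (n - size v)%N = k'.+1 by lia.
  have /andP[p0 px] := pos x k' v bx ltac:(lia).
  have /andP[_ py] := pos y k' v bxy ltac:(lia).
  have dif : eff_res y k'.+1 v - eff_res x k'.+1 v = 2 ^+ size v * (y v - x v).
    case: k' {k'n p0 px py} => [|k']; first by rewrite !eff_res1 mulrBr.
    have nchild c : ~~ suffix (c :: v) v.
      by apply/negP => /size_suffix; rewrite /= ltnn.
    rewrite !eff_resS !(nsuf _ _ (nchild _)).
    by ring.
  set r := eff_res x _ _ in px dif *; set r' := eff_res y _ _ in py dif *.
  have r0 := lt_le_trans p0 px; have r'0 := lt_le_trans p0 py.
  have -> : r^-1 - r'^-1 = (r' - r) / (r * r') by field; rewrite !gt_eqF.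
  have /andP[ax xb] := bx v vn; have /andP[ay yb] := bxy v vn.
  have c0 : 0 < 2 ^+ size v :> R by rewrite exprn_gt0.
  have k0 : 0 < k'.+1%:R :> R by rewrite ltr0n.
  rewrite dif normrM normrM normfV (gtr0_norm c0) (gtr0_norm (mulr_gt0 r0 r'0)).
  rewrite ler_pdivrMr ?mulr_gt0//.
  apply: (@le_trans _ _ (2 ^+ size v * (b - a))).
    by rewrite ler_pM2l// ler_norml; apply/andP; split; lra.
  have -> : 2 ^+ size v * (b - a) =
      (b - a) / (2 ^+ size v * (k'.+1%:R * a) ^+ 2) *
      ((2 ^+ size v * (k'.+1%:R * a)) * (2 ^+ size v * (k'.+1%:R * a))).
    by field; rewrite !gt_eqF.
  rewrite ler_wpM2l//.
    by rewrite divr_ge0 ?mulr_ge0 ?sqr_ge0 ?(ltW c0)//; lra.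
  by apply: ler_pM => //; exact: ltW.
elim: k w => [|k IHk] w wn wv.
  (* Here [w] is a leaf edge, so a [v] of length below [n] in its subtree must be [w] itself. *)
  have [wE|nwv] := eqVneq w v; first by rewrite wE in wn *; exact: root.
  move/suffixP: wv nwv vn => [[|c u] ->]; first by rewrite eqxx.
  by rewrite size_cat /=; lia.
have [wE|nwv] := eqVneq w v; first by rewrite wE in wn *; exact: root.
have wb : (size w < n)%N by lia.
have Pp z c : (forall t, (size t < n)%N -> a <= z t <= b) ->
    0 < eff_res z k.+1 (c :: w).
  move=> bz; have /andP[] := pos z k (c :: w) bz ltac:(rewrite /=; lia).
  exact: lt_le_trans.
have Ppar z : (forall t, (size t < n)%N -> a <= z t <= b) ->
    0 < parallel (eff_res z k.+1 (false :: w)) (eff_res z k.+1 (true :: w)).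
  by move=> bz; rewrite /parallel invr_gt0 addr_gt0 ?invr_gt0 ?Pp.
have r0 : 0 <= 2 ^+ size w * x w.
  by rewrite mulr_ge0 ?exprn_ge0//; have /andP[ax _] := bx w wb; lra.
rewrite !eff_resS -(xy w)//.
apply: (le_trans (inv_addl_contract r0 (Ppar x bx) (Ppar y bxy))).
rewrite /parallel !invrK.
(* Words grow at the front, so the letter of [v] just before the suffix [w] names the child whose
   subtree contains [v]. The sibling's conductance is unchanged and cancels. *)
move/suffixP: wv nwv => [u]; case/lastP: u => [|u c] vE.
  by rewrite vE eqxx.
rewrite cat_rcons in vE => _.
have cv : suffix (c :: w) v by rewrite vE suffix_suffix.
have ncv : ~~ suffix (~~ c :: w) v.
  apply/suffixP => -[u']; rewrite vE -!cat_rcons => E.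
  have uu' : size u = size u'.
    by have := congr1 size E; rewrite !size_cat !size_rcons; lia.
  move/eqP: E; rewrite eqseq_cat ?size_rcons ?uu'// eqseq_rcons.
  by case: c {vE cv} => /=; rewrite andbF.
have := IHk (c :: w) ltac:(rewrite /=; lia) cv; have := nsuf _ k.+1 ncv.
case: c {vE cv ncv} => /= ->.
  by rewrite opprD addrACA subrr add0r.
by rewrite opprD addrACA subrr addr0.
Qed.

End resistance.

(** * Influence of a single edge *)

(** A difference of resistances is the difference of conductances times the product of the two
    resistances, and each resistance is at most [n b]. *)
Lemma Rn_oscillation (R : realType) (a b : R) (n : nat) (v : seq bool)
    (x y : seq bool -> R) : 0 < a ->
  (forall u, (size u < n)%N -> a <= x u <= b) ->
  (forall u, (size u < n)%N -> a <= y u <= b) ->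
  (size v < n)%N -> (forall u, u != v -> x u = y u) ->
  Rn n x <= Rn n y +
    (b - a) * (b / a) ^+ 2 * ((size v).+1%:R ^+ 2 / 2 ^+ size v).
Proof.
move=> a0 bx bxy vn xy.
case: n => [//|n] in bx bxy vn *.
have ab : a <= b by have /andP[] := bx v vn; exact: le_trans.
have bnd z : (forall u, (size u < n.+1)%N -> a <= z u <= b) ->
    0 < Rn n.+1 z /\ Rn n.+1 z <= n.+1%:R * b.
  move=> bz; have := @eff_res_bounds _ z a b n.+1 n [::] a0 ltac:(by rewrite addn0) bz.
  rewrite !mul1r => /andP[zl zu]; split=> //.
  by apply: lt_le_trans zl; rewrite mulr_gt0// ltr0n.
have [x0 xb] := bnd x bx; have [y0 yb] := bnd y bxy.
have := @eff_res_inv_lipschitz _ x y a b n.+1 v n [::] a0 ltac:(by rewrite addn0)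
  bx bxy xy (suffix0s _) vn.
rewrite -/(Rn n.+1 x) -/(Rn n.+1 y).
move: (Rn n.+1 x) (Rn n.+1 y) x0 xb y0 yb => r r' r0 rb r'0 r'b.
set m := size v in vn *.
pose D := (b - a) / (2 ^+ m * ((n.+1 - m)%:R * a) ^+ 2).
rewrite -/D => hD.
have c0 : 0 < 2 ^+ m :> R by rewrite exprn_gt0.
have e0 : 0 < (n.+1 - m)%:R :> R by rewrite ltr0n; lia.
have m0 : 0 < m.+1%:R :> R by rewrite ltr0n.
(* This makes the bound uniform in the height: the right side exceeds the left by [m (n - m)], and
   the factor [n + 1 - m] cancels against the denominator of [D]. *)
have nm : n.+1%:R <= m.+1%:R * (n.+1 - m)%:R :> R.
  by rewrite -natrM ler_nat; nia.
have D0 : 0 <= D.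
  rewrite /D divr_ge0 ?subr_ge0//.
  by rewrite mulr_ge0 ?(ltW c0)// sqr_ge0.
have : r - r' <= D * (r * r').
  have -> : r - r' = (r'^-1 - r^-1) * (r * r') by field; rewrite !gt_eqF.
  rewrite ler_wpM2r ?mulr_ge0 ?(ltW r0) ?(ltW r'0)//.
  by apply: le_trans hD; rewrite distrC ler_norm.
suff : D * (r * r') <= (b - a) * (b / a) ^+ 2 * (m.+1%:R ^+ 2 / 2 ^+ m) by lra.
have -> : (b - a) * (b / a) ^+ 2 * (m.+1%:R ^+ 2 / 2 ^+ m) =
    D * ((m.+1%:R * (n.+1 - m)%:R * b) * (m.+1%:R * (n.+1 - m)%:R * b)).
  by rewrite /D; field; rewrite !gt_eqF.
have b0 : 0 < b by lra.
have nb : n.+1%:R * b <= m.+1%:R * (n.+1 - m)%:R * b by rewrite ler_pM2r.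
by rewrite ler_wpM2l// ler_pM ?(ltW r0) ?(ltW r'0)//; exact: le_trans nb.
Qed.

(** * Enumeration of the edges and the sum of squared influences *)

Fixpoint edge_seq (n : nat) : seq (seq bool) :=
  if n is n'.+1 then
    [::] :: [seq false :: w | w <- edge_seq n'] ++ [seq true :: w | w <- edge_seq n']
  else [::].

Lemma mem_edge_seq n w : (w \in edge_seq n) = (size w < n)%N.
Proof.
elim: n w => [//|n IHn] [//|c w] /=; rewrite inE /= mem_cat ltnS -IHn.
have inj e : injective (cons e : seq bool -> seq bool) by move=> ? ? [].
have nin e : c != e -> (c :: w \in [seq e :: w0 | w0 <- edge_seq n]) = false.
  by move=> ce; apply/mapP => -[w' _ [/eqP]]; rewrite (negbTE ce).
case: c nin => nin.
  by rewrite nin//= mem_map.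
by rewrite [X in _ || X]nin//= orbF mem_map.
Qed.

Lemma edge_seq_uniq n : uniq (edge_seq n).
Proof.
elim: n => [//|n IHn] /=.
have inj e : injective (cons e : seq bool -> seq bool) by move=> ? ? [].
rewrite mem_cat cat_uniq !map_inj_uniq// IHn /= andbT; apply/andP; split.
  by rewrite negb_or; apply/andP; split; apply/mapP => -[].
by apply/hasPn => _ /mapP[w _ ->]; apply/mapP => -[].
Qed.

Lemma sum_edge_seq (R : realType) n (g : nat -> R) :
  \sum_(w <- edge_seq n) g (size w) = \sum_(l < n) 2 ^+ l * g l.
Proof.
elim: n g => [|n IHn] g /=; first by rewrite big_nil big_ord0.
rewrite big_cons big_cat !big_map /= (IHn (fun k => g k.+1)) big_ord_recl mul1r.
congr (_ + _); rewrite -big_split; apply: eq_bigr => l _.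
by rewrite !lift0 exprS /=; ring.
Qed.

(* The numerator is the polynomial p with p(l) - p(l+1)/2 = (l+1)^4, so that the
   series telescopes; p(0) = 300. *)
Lemma sum_pow4_half (R : realType) n :
  \sum_(l < n) l.+1%:R ^+ 4 / 2 ^+ l =
  300 - (2 * n.+1%:R ^+ 4 + 8 * n.+1%:R ^+ 3 + 36 * n.+1%:R ^+ 2
         + 104 * n.+1%:R + 150) / 2 ^+ n :> R.
Proof.
elim: n => [|n IHn]; first by rewrite big_ord0 expr0; field.
rewrite big_ord_recr /= IHn -[n.+2%:R]natr1 [2 ^+ n.+1]exprS.
by field; rewrite expf_neq0.
Qed.

(** A word of length [l] contributes [K^2 (l+1)^4 / 4^l], and there are [2^l] of them; the resulting
    partial sums stay below [300 K^2]. *)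
Lemma edge_weight_sum_le (R : realType) n (K : R) :
  \sum_(w <- edge_seq n) (K * ((size w).+1%:R ^+ 2 / 2 ^+ size w)) ^+ 2 <= 300 * K ^+ 2.
Proof.
rewrite (sum_edge_seq n (fun l => (K * (l.+1%:R ^+ 2 / 2 ^+ l)) ^+ 2)).
rewrite (eq_bigr (fun l : 'I_n => K ^+ 2 * (l.+1%:R ^+ 4 / 2 ^+ l))); last first.
  move=> l _; field.
  by rewrite expf_neq0.
rewrite -mulr_sumr mulrC ler_wpM2r ?sqr_ge0// sum_pow4_half gerBl.
by rewrite divr_ge0 ?exprn_ge0// !addr_ge0 ?mulr_ge0 ?exprn_ge0.
Qed.

(** * Measurability of the effective resistance *)

(** Inversion is total and continuous away from 0; the point 0 is treated as a separate measurable
    piece. *)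
Lemma measurable_inv (R : realType) : measurable_fun setT (@GRing.inv R).
Proof.
rewrite -(setUv [set 0 : R]); apply/measurable_funU => //.
  exact: measurableC.
split; first exact: measurable_fun_set1.
apply: open_continuous_measurable_fun; last first.
  by move=> x /set_mem /eqP x0; exact: inv_continuous.
by rewrite openC; exact: closed_eq.
Qed.

Lemma coord_measurable_eff_res (R : realType) k w :
  coord_measurable (fun x : seq bool -> R => eff_res x k w).
Proof.
move=> d E Y mY.
elim: k w => [//|[|k] IHk] w.
  rewrite (_ : (fun _ => _) = (fun e => 2 ^+ size w * Y w e)).
    exact: measurable_funM.
  by apply/funext => e; rewrite eff_res1.
apply: measurable_funD; first exact: measurable_funM.
apply: measurableT_comp; first exact: measurable_inv.
by apply: measurable_funD; apply: (measurableT_comp (@measurable_inv R));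
  exact: IHk.
Qed.

(** * Concentration of the effective resistance *)

Theorem theorem7 (R : realType) (a b : R) :
  0 < a -> a < b ->
  exists C : R, 0 < C /\
    forall (n : nat) (d : measure_display) (T : measurableType d)
      (P : probability T R) (X : seq bool -> {RV P >-> R}),
      (1 <= n)%N ->
      (* X_e takes values in [a, b] *)
      (forall w, edges_T n w -> forall om, a <= X w om <= b) ->
      (* the X_e are i.i.d.: identically distributed (as X_root) ... *)
      (forall w, edges_T n w -> forall B : set R, measurable B ->
         P (X w @^-1` B) = P (X [::] @^-1` B)) ->
      (* ... and mutually independent *)
      mutually_independent P (edges_T n) (fun w => (X w : T -> R)) ->
      forall t : R, 0 < t ->
        (P [set om | (t%:E < `| (Rn n (fun w => X w om))%:E
                          - 'E_P[fun om' => Rn n (fun w => X w om')] |)%E]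
          <= 2%:E * (expR (- t ^+ 2 / (4 * C)))%:E)%E.
Proof.
move=> a0 ab.
pose K := (b - a) * (b / a) ^+ 2.
have K0 : 0 < K by rewrite mulr_gt0 ?subr_gt0// exprn_gt0// divr_gt0//; lra.
have S0 : 0 < 300 * K ^+ 2 by rewrite mulr_gt0// exprn_gt0.
(* Chosen so that [4 C = 8 S] with [S = 300 K^2]. *)
exists (2 * (300 * K ^+ 2)); split; first exact: mulr_gt0.
move=> n d T P X n1 boxX _ indX t t0.
(* All edges of the tree are resampled, so the default [a], itself in the box, is never read. *)
have E om : Rn n (fun w => X w om) = Rn n (resample X (fun=> a) (edge_seq n) om).
  apply: eq_eff_res => u un.
  by rewrite /resample cats0 mem_edge_seq un.
have bM y : in_box (edges_T n) a b y -> 0 <= Rn n y <= n%:R * b.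
  case: n n1 {boxX indX E} => // n _ boxy.
  have := @eff_res_bounds _ y a b n.+1 n [::] a0 ltac:(by rewrite addn0) boxy.
  rewrite !mul1r => /andP[zl ->]; rewrite andbT; apply: le_trans zl.
  by rewrite mulr_ge0// ltW.
have mR : coord_measurable (@Rn R n) := coord_measurable_eff_res n [::].
have bxa : in_box (edges_T n) a b (fun=> a) by move=> w _; rewrite lexx ltW.
have EE : ('E_P[fun om' => Rn n (fun w => X w om')] =
    (\int[P]_om' Rn n (resample X (fun=> a) (edge_seq n) om'))%R%:E)%E.
  rewrite unlock; under eq_integral do rewrite E.
  rewrite fineK//; apply: integrable_fin_num => //.
  have mRX := @measurable_resample _ _ _ _ _ X _ mR (fun=> a) (edge_seq n).
  apply: (bounded_integrable P mRX) => om.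
  exact: (resample_norm_le boxX bM _ om bxa).
rewrite EE (_ : [set om | _] = [set om | t < `|Rn n (resample X (fun=> a) (edge_seq n) om)
   - \int[P]_om' Rn n (resample X (fun=> a) (edge_seq n) om')|]); last first.
  by apply/seteqP; split=> om /=; rewrite E lte_fin.
rewrite (_ : 4 * _ = 8 * (300 * K ^+ 2)); last by ring.
apply: (mcdiarmid indX boxX mR bM _ (edge_seq_uniq n) _ bxa S0
  (edge_weight_sum_le n K)) => //.
  move=> v y z vn boxy boxz yz; apply: Rn_oscillation => //.
by move=> w; rewrite mem_edge_seq.
Qed.
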